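(* Let $k,\nu$ be parameters with $2k$ a positive integer and $\nu>0$. On the Siegel--Jacobi upper half-plane $\mathcal{X}^J_1=\{(v,u)\in\mathbb{C}^2 : \operatorname{Im} v>0\}$, with $v=x+\mathrm{i}y$ and $u=m+\mathrm{i}n$ ($x,y,m,n\in\mathbb{R}$), consider the K\''ahler potential $$f(v,u)=-\frac{k}{2}\log\frac{v-\bar v}{2\mathrm{i}}-\mathrm{i}\nu\,\frac{(u-\bar u)^2}{v-\bar v}.$$ Then the Berry connection associated with $f$ in the holomorphic coordinates $(v,u)$ is $$A_B(x,y,m,n)=\frac1y\left[-\Big(\frac{k}{4}+\nu\frac{n^2}{y}\Big)dx+2\nu n\,dm\right].$$
   Context: Given a (real-valued) K\''ahler potential $f$ in complex coordinates $(z_\alpha)$, the Berry connection is the real 1-form $A_B=\frac{\mathrm{i}}{2}\sum_\alpha\Big(\frac{\partial f}{\partial z_\alpha}dz_\alpha-\frac{\partial f}{\partial\bar z_\alpha}d\bar z_\alpha\Big)=-\operatorname{Im}\sum_\alpha\frac{\partial f}{\partial z_\alpha}dz_\alpha$, where $\partial/\partial z_\alpha$ and $\partial/\partial\bar z_\alpha$ are the Wirtinger derivatives. *)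

(* Defs.v *)
From Stdlib Require Import Reals.
From Coquelicot Require Import Coquelicot.

Open Scope C_scope.

(* Points of C^2, and also real tangent vectors at such points: a tangent
   vector w carries dz_1(w) = fst w and dz_2(w) = snd w. *)
Definition C2 : Type := (C * C)%type.

Definition C2_R_NormedModule : NormedModule R_AbsRing :=
  prod_NormedModule R_AbsRing C_R_NormedModule C_R_NormedModule.

Definition ex_real_differential (f : C2 -> C) (p : C2) : Prop :=
  @ex_filterdiff R_AbsRing C2_R_NormedModule C_R_NormedModule f
    (@locally C2_R_NormedModule p).

(* Derivative at t = 0 of the complex-valued function t |-> f (p + t w) of the
   real variable t, taken on the real and imaginary parts. *)
Definition real_dir_deriv (f : C2 -> C) (p w : C2) : C :=
  let g := fun t : R =>
    f (fst p + RtoC t * fst w, snd p + RtoC t * snd w) in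
  (Derive (fun t => Re (g t)) 0, Derive (fun t => Im (g t)) 0).

(* With z_j = a_j + i b_j, the vectors e_j and i e_j are the directions of
   d/da_j and d/db_j. *)
Definition e1 : C2 := (RtoC 1, RtoC 0).
Definition e2 : C2 := (RtoC 0, RtoC 1).
Definition Ci_scal (w : C2) : C2 := (Ci * fst w, Ci * snd w).

Definition wirtinger (f : C2 -> C) (e p : C2) : C :=
  / 2 * (real_dir_deriv f p e - Ci * real_dir_deriv f p (Ci_scal e)).

Definition wirtinger_bar (f : C2 -> C) (e p : C2) : C :=
  / 2 * (real_dir_deriv f p e + Ci * real_dir_deriv f p (Ci_scal e)).

Definition Berry_connection (f : C2 -> C) (p w : C2) : C :=
  Ci / 2 *
    ((wirtinger f e1 p * fst w - wirtinger_bar f e1 p * Cconj (fst w)) +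
     (wirtinger f e2 p * snd w - wirtinger_bar f e2 p * Cconj (snd w))).

Definition Siegel_Jacobi (p : C2) : Prop := (0 < Im (fst p))%R.

(* On the domain (v - conj v) / 2i = Im v is a positive real number, so the
   logarithm is the real one, applied to the real part of this quotient. *)
Definition kahler_potential (k nu : R) (p : C2) : C :=
  let v := fst p in
  let u := snd p in
  - (RtoC k / 2) * RtoC (ln (Re ((v - Cconj v) / (2 * Ci))))
  - Ci * RtoC nu * ((u - Cconj u) * (u - Cconj u) / (v - Cconj v)).

(* Main.v *)
Require Import Defs.
From Stdlib Require Import Reals Lra.
From Coquelicot Require Import Coquelicot.

(** The potential depends only on the imaginary parts [y = Im v], [n = Im u]:
    it equals [F (y, n) = - (k / 2) ln y + 2 nu n^2 / y].  Hence its Wirtinger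
    derivatives are [- (i / 2)] times the partial derivatives of [F], and the
    Berry connection is [(1 / 2) (dF/dy dx + dF/dn dm)]. *)

Definition real_potential (k nu y n : R) : R :=
  (- (k / 2) * ln y + 2 * nu * (n ^ 2 / y))%R.

Lemma Cminus_conj (z : C) : (z - Cconj z = RtoC (2 * Im z) * Ci)%C.
Proof.
destruct z as [x y]; unfold Cconj, Ci, RtoC.
apply injective_projections; simpl; ring.
Qed.

Lemma Cinv_RtoC_0 : (/ RtoC 0)%C = RtoC 0.
Proof. apply injective_projections; simpl; unfold Rdiv; ring. Qed.

(* At [Im v = 0] the identity holds because both divisions by zero give [0]. *)
Lemma kahler_potentialE (k nu : R) (p : C2) :
  kahler_potential k nu p
  = RtoC (real_potential k nu (Im (fst p)) (Im (snd p))).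
Proof.
unfold kahler_potential, real_potential; cbv zeta.
rewrite !Cminus_conj.
generalize (Im (fst p)) (Im (snd p)); intros y n.
replace (Re (RtoC (2 * y) * Ci / (2 * Ci)))%C with y
  by (unfold Ci; simpl; field).
assert (Hq : (RtoC (2 * n) * Ci * (RtoC (2 * n) * Ci) / (RtoC (2 * y) * Ci)
             = Ci * RtoC (2 * (n ^ 2 / y)))%C).
{ destruct (Req_dec y 0) as [-> | Hy].
  - rewrite Rmult_0_r, Cmult_0_l.
    unfold Cdiv, Rdiv; rewrite Cinv_RtoC_0, Rinv_0, !Rmult_0_r; ring.
  - unfold Ci, RtoC; apply injective_projections; simpl; field; lra. }
rewrite Hq.
generalize (ln y) (n ^ 2 / y)%R; intros l q; unfold Ci, RtoC.
apply injective_projections; simpl; field.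
Qed.

Lemma is_derive_real_potential_line (k nu y n b d : R) :
  (0 < y)%R ->
  is_derive (fun t => real_potential k nu (y + t * b) (n + t * d)) 0
    (- (k / 2) * (b / y) + 2 * nu * (2 * n * d / y - n ^ 2 * b / y ^ 2)).
Proof.
intros Hy; unfold real_potential; auto_derive.
- rewrite Rmult_0_l, Rplus_0_r; repeat split; lra.
- field; lra.
Qed.

Lemma real_dir_deriv_kahler_potential (k nu : R) (p w : C2) :
  Siegel_Jacobi p ->
  real_dir_deriv (kahler_potential k nu) p w
  = RtoC (- (k / 2) * (Im (fst w) / Im (fst p))
          + 2 * nu * (2 * Im (snd p) * Im (snd w) / Im (fst p)
                      - Im (snd p) ^ 2 * Im (fst w) / Im (fst p) ^ 2)).
Proof.
intros Hp; unfold real_dir_deriv; cbv zeta.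
apply injective_projections; cbn [fst snd RtoC].
- apply is_derive_unique.
  apply (is_derive_ext (fun t => real_potential k nu
    (Im (fst p) + t * Im (fst w)) (Im (snd p) + t * Im (snd w)))).
  + intros t; rewrite kahler_potentialE; simpl.
    unfold Im; f_equal; ring.
  + exact (is_derive_real_potential_line k nu _ _ _ _ Hp).
- rewrite (Derive_ext _ (fun _ => 0%R)).
  + apply Derive_const.
  + intros t; rewrite kahler_potentialE; reflexivity.
Qed.

Lemma ex_real_differential_kahler_potential (k nu : R) (p : C2) :
  Siegel_Jacobi p -> ex_real_differential (kahler_potential k nu) p.
Proof.
intros Hp; unfold ex_real_differential.
set (T := C2_R_NormedModule).
assert (Hy : @ex_filterdiff R_AbsRing T R_NormedModule
  (fun q : C2 => Im (fst q)) (locally p)).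
{ apply ex_filterdiff_linear.
  exact (is_linear_comp _ _
    (@is_linear_fst R_AbsRing C_R_NormedModule C_R_NormedModule)
    (@is_linear_snd R_AbsRing R_NormedModule R_NormedModule)). }
assert (Hn : @ex_filterdiff R_AbsRing T R_NormedModule
  (fun q : C2 => Im (snd q)) (locally p)).
{ apply ex_filterdiff_linear.
  exact (is_linear_comp _ _
    (@is_linear_snd R_AbsRing C_R_NormedModule C_R_NormedModule)
    (@is_linear_snd R_AbsRing R_NormedModule R_NormedModule)). }
assert (Hcomp : forall g : R -> R, ex_derive g (Im (fst p)) ->
  @ex_filterdiff R_AbsRing T R_NormedModule (fun q : C2 => g (Im (fst q))) (locally p)).
{ intros g Hg.
  apply (@ex_filterdiff_comp' R_AbsRing T R_NormedModule R_NormedModule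
    (fun q : C2 => Im (fst q)) g p Hy).
  now apply ex_derive_filterdiff. }
unfold Siegel_Jacobi in Hp.
apply (@ex_filterdiff_ext R_AbsRing T C_R_NormedModule _ _ (fun q : C2 =>
  @scal R_AbsRing C_R_NormedModule
    (real_potential k nu (Im (fst q)) (Im (snd q))) (RtoC 1))).
{ intros q; rewrite kahler_potentialE.
  apply injective_projections; simpl; unfold scal; simpl; unfold mult; simpl;
    ring. }
apply (@ex_filterdiff_scal_l_fct R_AbsRing T C_R_NormedModule _ _).
apply (@ex_filterdiff_plus_fct R_AbsRing T R_NormedModule _ _).
- apply (Hcomp (fun y => - (k / 2) * ln y)%R); auto_derive; lra.
- apply (@ex_filterdiff_ext R_AbsRing T R_NormedModule _ _ (fun q : C2 =>
    @mult R_AbsRing (@mult R_AbsRing (Im (snd q)) (Im (snd q)))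
      (2 * nu / Im (fst q))%R)).
  { intros q; unfold mult; simpl; unfold Rdiv; ring. }
  apply (@ex_filterdiff_mult_fct R_AbsRing T); [exact Rmult_comm | | ].
  + now apply (@ex_filterdiff_mult_fct R_AbsRing T); [exact Rmult_comm | | ].
  + apply (Hcomp (fun y => 2 * nu / y)%R); auto_derive; lra.
Qed.

Theorem mainTheorem2 :
  forall k nu : R,
    (exists N : nat, (0 < N)%nat /\ (2 * k)%R = INR N) ->
    (0 < nu)%R ->
    (forall p : C2, Siegel_Jacobi p ->
       Im (kahler_potential k nu p) = 0%R /\
       ex_real_differential (kahler_potential k nu) p) /\
    (forall x y m n : R,
       Siegel_Jacobi ((x, y), (m, n)) ->
       forall dx dy dm dn : R,
         Berry_connection (kahler_potential k nu)
           ((x, y), (m, n)) ((dx, dy), (dm, dn)) =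
         RtoC (1 / y * (- (k / 4 + nu * (n ^ 2 / y)) * dx
                        + 2 * nu * n * dm))%R).
Proof.
intros k nu _ _; split.
- intros p Hp; split.
  + now rewrite kahler_potentialE.
  + now apply ex_real_differential_kahler_potential.
- intros x y m n Hp dx dy dm dn.
  unfold Berry_connection, wirtinger, wirtinger_bar.
  rewrite !real_dir_deriv_kahler_potential by exact Hp.
  unfold Siegel_Jacobi in Hp; simpl in Hp.
  unfold e1, e2, Ci_scal, Cconj, Ci, RtoC.
  apply injective_projections; simpl; field; lra.
Qed.
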